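(* Let $\Phi=(\Gamma,\phi)$ be a $\mathbb{T}^{-1}$-gain graph on a finite simple graph $\Gamma$. If $\lambda$ is an eigenvalue of $A(\Lambda(\Phi))$ (that is, of $A(\Psi)$ for any gain graph $\Psi$ in the switching class $\Lambda(\Phi)$), then $\lambda\le 2$.
   Context: All graphs are finite and simple. $\mathbb{T}=\{z\in\mathbb{C}:|z|=1\}$ under multiplication; $\mathbb{T}^{-1}$ denotes the group $\mathbb{T}$ together with the distinguished element $\mathfrak{s}=-1$ (the superscript only records this choice). For an edge $e=v_iv_j$ of a graph $\Gamma=(V,E)$, write $e_{ij}$ both for the edge and for the oriented edge from $v_i$ to $v_j$. A $\mathbb{T}^{\mathfrak{s}}$-gain graph $\Phi=(\Gamma,\phi)$ is a graph $\Gamma$ with a function $\phi$ from the oriented edges (two opposite orientations for each edge) to $\mathbb{T}$ with $\phi(e_{ij})=\phi(e_{ji})^{-1}$. For $\zeta:V\to\mathbb{T}$, the switched gain graph is $\Phi^\zeta=(\Gamma,\phi^\zeta)$ with $\phi^\zeta(e_{ij})=\zeta(v_i)^{-1}\phi(e_{ij})\zeta(v_j)$. The switching class $[\Phi]$ is the set of all $\Phi^\zeta$. An incidence phase function on $\Gamma$ is a function $\omega:V\times E\to\mathbb{T}\cup\{0\}$ with $\omega(v,e)\neq0$ if $v$ is incident to $e$ and $\omega(v,e)=0$ otherwise. The gain graph $\Phi(\omega)$ associated to $\omega$ has gains $$\phi(e_{ij})=\omega(v_i,e_{ij})\cdot\mathfrak{s}\cdot\omega(v_j,e_{ij})^{-1}.$$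 An orientation of $\Phi$ is an incidence phase function $\omega$ with $\Phi(\omega)=\Phi$. Let $\Lambda_\Gamma$ be the usual line graph of $\Gamma$ (vertices are the edges of $\Gamma$; two distinct edges are adjacent iff they share an endpoint). Given $\omega$ on $\Gamma$, define an incidence phase function $\omega_\Lambda$ on $\Lambda_\Gamma$ as follows: if $e,f$ are distinct edges of $\Gamma$ sharing the (unique) vertex $v$, then for the edge $ef$ of $\Lambda_\Gamma$ set $\omega_\Lambda(e,ef)=\omega(v,e)^{-1}$ and $\omega_\Lambda(f,ef)=\omega(v,f)^{-1}$; $\omega_\Lambda$ is $0$ on non-incident pairs. $\Phi(\omega_\Lambda)$ is the gain graph on $\Lambda_\Gamma$ whose gains are computed from $\omega_\Lambda$ by the displayed formula with the same $\mathfrak{s}$. The line graph $\Lambda(\Phi)$ of $\Phi$ is the switching class $[\Phi(\omega_\Lambda)]$, where $\omega$ is any orientation of $\Phi$ (the class does not depend on the choice of $\omega$). The adjacency matrix $A(\Psi)$ of a gain graph $\Psi$ with gain function $\psi$ has $(i,j)$ entry $\psi(e_{ij})$ if the $i$-th and $j$-th vertices are adjacent and $0$ otherwise; it is Hermitian. $A(\Lambda(\Phi))$ means $A(\Psi)$ for a representative $\Psi\in\Lambda(\Phi)$; its eigenvalues do not depend on the representative. *)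

(* Defs.v *)
From HB Require Import structures.
From mathcomp Require Import all_boot all_order all_algebra.
From mathcomp Require Import reals complex ring.

Set Implicit Arguments.
Unset Strict Implicit.
Unset Printing Implicit Defensive.

Import Order.TTheory GRing.Theory Num.Theory.
Local Open Scope ring_scope.

Record sgraph := SGraph {
  vertex :> finType;
  adj : rel vertex;
  adj_sym : symmetric adj;
  adj_irrefl : irreflexive adj }.

Definition edges (G : sgraph) : {set {set G}} :=
  [set e | [exists u, exists v, adj u v && (e == [set u; v])]].

Definition edge (G : sgraph) := {e : {set G} | e \in edges G}.

Lemma edgesP (G : sgraph) (e : {set G}) :
  reflect (exists u v, adj u v /\ e = [set u; v]) (e \in edges G).
Proof.
rewrite inE; apply: (iffP existsP) => -[u].
  by case/existsP=> v /andP[uv /eqP ->]; exists u, v.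
by case=> v [uv ->]; exists u; apply/existsP; exists v; rewrite uv eqxx.
Qed.

Lemma adj_edge (G : sgraph) (u v : G) : adj u v -> [set u; v] \in edges G.
Proof. by move=> uv; apply/edgesP; exists u, v. Qed.

Section LineGraph.
Variable G : sgraph.

Definition line_adj (e f : edge G) :=
  (e != f) && [exists v, (v \in val e) && (v \in val f)].

Lemma line_adj_sym : symmetric line_adj.
Proof.
move=> e f; rewrite /line_adj eq_sym; congr (_ && _).
by apply: eq_existsb => v; rewrite andbC.
Qed.

Lemma line_adj_irrefl : irreflexive line_adj.
Proof. by move=> e; rewrite /line_adj eqxx. Qed.

Definition line_graph := SGraph line_adj_sym line_adj_irrefl.

End LineGraph.

Section Gains.
Variable C : numClosedFieldType.

(* The values of [gain] off the adjacent pairs are irrelevant: every notion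
   below, including equality [gain_eq], only looks at adjacent pairs. *)
Record gain_graph (G : sgraph) := GainGraph {
  gain :> G -> G -> C;
  gain_norm : forall u v, adj u v -> `|gain u v| = 1;
  gain_inv : forall u v, adj u v -> gain u v = (gain v u)^-1 }.

Definition gain_eq (G : sgraph) (Phi Psi : gain_graph G) :=
  forall u v : G, adj u v -> Phi u v = Psi u v.

Definition adjacency (G : sgraph) (Phi : gain_graph G) : 'M[C]_#|G| :=
  \matrix_(i, j) (if adj (enum_val i) (enum_val j)
                  then Phi (enum_val i) (enum_val j) else 0).

Section Switching.
Variables (G : sgraph) (Phi : gain_graph G) (zeta : G -> C).
Hypothesis zeta1 : forall v, `|zeta v| = 1.

Definition switch_fun (u v : G) := (zeta u)^-1 * Phi u v * zeta v.

Lemma switch_norm u v : adj u v -> `|switch_fun u v| = 1.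
Proof. by move=> uv; rewrite !normrM normfV !zeta1 gain_norm // invr1 !mulr1. Qed.

Lemma switch_inv u v : adj u v -> switch_fun u v = (switch_fun v u)^-1.
Proof.
by move=> uv; rewrite /switch_fun (gain_inv Phi uv) !invfM invrK -mulrA [LHS]mulrC
  [_^-1 * _]mulrC.
Qed.

Definition switch := GainGraph switch_norm switch_inv.

End Switching.

Definition switching_class (G : sgraph) (Phi Psi : gain_graph G) :=
  exists (zeta : G -> C) (zeta1 : forall v, `|zeta v| = 1),
    gain_eq Psi (switch Phi zeta1).

(* [phase v e] is meant for [e \in edges G]; it is extended by 0 to the sets
   [e] that are not edges. *)
Record incidence_phase (G : sgraph) := IncidencePhase {
  phase :> G -> {set G} -> C;
  phase_norm : forall v e, e \in edges G -> v \in e -> `|phase v e| = 1;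
  phase0 : forall v e, ~~ ((e \in edges G) && (v \in e)) -> phase v e = 0 }.

(* The distinguished element of the circle group. *)
Definition frak_s : C := -1.

Section GainOfPhase.
Variables (G : sgraph) (omega : incidence_phase G).

Definition phase_gain_fun (u v : G) :=
  omega u [set u; v] * frak_s * (omega v [set u; v])^-1.

Lemma phase_gain_norm u v : adj u v -> `|phase_gain_fun u v| = 1.
Proof.
move=> uv; rewrite !normrM normfV normrN1 !phase_norm ?adj_edge ?set21 ?set22 //.
by rewrite invr1 !mulr1.
Qed.

Lemma phase_gain_inv u v :
  adj u v -> phase_gain_fun u v = (phase_gain_fun v u)^-1.
Proof.
move=> _; rewrite /phase_gain_fun [[set v; u]]setUC !invfM invrK.
by rewrite /frak_s invrN1 -mulrA [LHS]mulrC [_ * _^-1]mulrC.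
Qed.

Definition phase_gain := GainGraph phase_gain_norm phase_gain_inv.

End GainOfPhase.

Definition orientation (G : sgraph) (Phi : gain_graph G)
  (omega : incidence_phase G) := gain_eq (phase_gain omega) Phi.

Section LinePhase.
Variables (G : sgraph) (omega : incidence_phase G).

(* For an edge [F = [set e; f]] of the line graph, the vertex picked is the
   unique common endpoint of [e] and [f]. *)
Definition line_phase_fun (e : line_graph G) (F : {set line_graph G}) : C :=
  if (F \in edges (line_graph G)) && (e \in F) then
    if [pick v | [forall f in F, v \in val f]] is Some v
    then (omega v (val e))^-1 else 0
  else 0.

Lemma line_phase_norm e F : F \in edges (line_graph G) -> e \in F ->
  `|line_phase_fun e F| = 1.
Proof.
move=> FE eF; rewrite /line_phase_fun FE eF /=; case: pickP => [v /forall_inP vF|].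
  by rewrite normfV phase_norm ?invr1 ?vF //; apply: valP.
case/edgesP: FE => f [g [/andP[_ /existsP[v /andP[vf vg]]] ->]] /(_ v)/negP[].
by apply/forall_inP => h; rewrite !inE => /orP[]/eqP->.
Qed.

Lemma line_phase0 e F : ~~ ((F \in edges (line_graph G)) && (e \in F)) ->
  line_phase_fun e F = 0.
Proof. by rewrite /line_phase_fun => /negPf ->. Qed.

Definition line_phase := IncidencePhase line_phase_norm line_phase0.

End LinePhase.

(* The class does not depend on the orientation: see [exists_orientation] and
   [line_class_indep]. *)
Definition line_class (G : sgraph) (Phi : gain_graph G)
    (Psi : gain_graph (line_graph G)) :=
  exists2 omega, orientation Phi omega &
    switching_class (phase_gain (line_phase omega)) Psi.


Lemma exists_orientation (G : sgraph) (Phi : gain_graph G) :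
  exists omega, orientation Phi omega.
Proof.
pose other (e : {set G}) v := [pick u | adj v u && (e == [set v; u])].
pose w v (e : {set G}) : C := if (e \in edges G) && (v \in e) then
  if [pick x in e] == Some v then 1 else
  if other e v is Some u then - Phi v u else 0 else 0.
have otherE u v : adj u v -> other [set u; v] u = Some v.
  move=> uv; rewrite /other; case: pickP => [x /andP[ux /eqP E]|/(_ v)]; last first.
    by rewrite uv eqxx.
  have : v \in [set u; x] by rewrite -E set22.
  rewrite !inE => /orP[]/eqP vE; last by rewrite vE.
  by move: uv; rewrite vE adj_irrefl.
have w1 v e : e \in edges G -> v \in e -> `|w v e| = 1.
  move=> eE ve; rewrite /w eE ve /=; case: ifP => _; first exact: normr1.
  suff [u [vu ->]] : exists u, adj v u /\ e = [set v; u].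
    by rewrite otherE // normrN gain_norm.
  case/edgesP: eE ve => x [y [xy ->]]; rewrite !inE => /orP[]/eqP->.
    by exists y.
  by exists x; rewrite adj_sym setUC.
have w0 v e : ~~ ((e \in edges G) && (v \in e)) -> w v e = 0.
  by rewrite /w => /negPf->.
exists (IncidencePhase w1 w0) => u v uv; rewrite /= /phase_gain_fun /= /w.
rewrite adj_edge // set21 set22 /= otherE // [in other _ v]setUC.
rewrite otherE 1?adj_sym //; have uDv : u != v.
  by apply/eqP => E; move: uv; rewrite E adj_irrefl.
case: pickP => [x|/(_ u)]; last by rewrite set21.
rewrite !inE => /orP[]/eqP->; rewrite eqxx.
  have /negPf-> : Some u != Some v by [].
  by rewrite mul1r invrN mulN1r opprK -gain_inv.
have /negPf-> : Some v != Some u by rewrite eq_sym.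
by rewrite invr1 mulr1 mulrN1 opprK.
Qed.

Lemma line_class_indep (G : sgraph) (Phi : gain_graph G) omega Psi :
  orientation Phi omega ->
  line_class Phi Psi <-> switching_class (phase_gain (line_phase omega)) Psi.
Proof.
move=> Pw; split=> [|Pp]; last by exists omega.
case=> w Pw' [zeta [zeta1 PsiE]].
have nz (o : incidence_phase G) (e : edge G) v : v \in val e -> o v (val e) != 0.
  by move=> ve; rewrite -normr_gt0 phase_norm ?ltr01 //; apply: valP.
pose t (e : edge G) := if [pick v in val e] is Some v
  then omega v (val e) / w v (val e) else 1.
have tE (e : edge G) v : v \in val e -> t e = omega v (val e) / w v (val e).
  move=> ve; rewrite /t; case: pickP => [u ue|/(_ v)]; last by rewrite ve.
  have [->//|uDv] := eqVneq u v.
  have [uv eE] : adj u v /\ val e = [set u; v].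
    have /edgesP[x [y [xy E]]] := valP e; move: ue ve uDv; rewrite E !inE.
    move=> /orP[]/eqP-> /orP[]/eqP->; rewrite ?eqxx // => _.
    by rewrite setUC adj_sym.
  have := Pw _ _ uv; rewrite -(Pw' _ _ uv) /= /phase_gain_fun -eE /frak_s.
  rewrite !mulrN1 !mulNr => /oppr_inj H.
  have -> : omega u (val e) = w u (val e) / w v (val e) * omega v (val e).
    by rewrite -H divfK // nz.
  by rewrite mulrAC [_ / w v _ / _]mulrAC divff ?nz // mul1r mulrC.
have t1 e : `|t e| = 1.
  rewrite /t; case: pickP => [v ve|_]; last exact: normr1.
  by rewrite normrM normfV !phase_norm ?invr1 ?mulr1 //; apply: valP.
have zt1 e : `|(t e)^-1 * zeta e| = 1.
  by rewrite normrM normfV t1 zeta1 invr1 mulr1.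
exists (fun e => (t e)^-1 * zeta e), zt1 => e f ef; rewrite (PsiE _ _ ef) /=.
rewrite /switch_fun /= /phase_gain_fun /= /line_phase_fun adj_edge // set21 set22 /=.
case: pickP => [v /forall_inP vF|]; last first.
  case/andP: ef => _ /existsP[v /andP[ve vf]] /(_ v)/negP[].
  by apply/forall_inP => h; rewrite !inE => /orP[]/eqP->.
have ve := vF e (set21 _ _); have vf := vF f (set22 _ _).
rewrite (tE _ _ ve) (tE _ _ vf).
have := (nz omega _ _ ve, nz omega _ _ vf, nz w _ _ ve, nz w _ _ vf).
have : zeta e != 0 by rewrite -normr_gt0 zeta1 ltr01.
move: (omega v _) (omega v _) (w v _) (w v _) (zeta e) (zeta f) => a b c d x y.
move=> x0 [[[a0 b0] c0] d0]; field.
by rewrite ?x0 ?a0 ?b0 ?c0 ?d0.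
Qed.

End Gains.

(* Main.v *)
Require Import Defs.
From mathcomp Require Import all_boot all_order all_algebra.
From mathcomp Require Import reals complex.

Import Order.TTheory GRing.Theory Num.Theory.
Local Open Scope ring_scope.

(** A representative of the line graph satisfies [A = 2 I - B B*], where [B] is
    the conjugate transpose of the incidence matrix of an orientation, each
    edge being rescaled by the switching function.  Entrywise, [B B*] sums
    over the common endpoints of two edges: an edge shares both its endpoints
    with itself, which gives 2 on the diagonal, and two adjacent edges share
    exactly one, which gives the opposite of the gain between them, because
    the distinguished element is -1 ([adjacency_line_class]).  As [B B*] is
    positive semidefinite, no eigenvalue of [A] exceeds 2
    ([eigenvalue_le_sub_gram]). *)

Section Gram.
Variable C : numClosedFieldType.

Local Notation "M ^*t" := (map_mx Num.conj (M^T)) (at level 8).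

Lemma row_sqnormE {n : nat} (x : 'rV[C]_n) :
  (x *m x^*t) 0 0 = \sum_i `|x 0 i| ^+ 2.
Proof. by rewrite mxE; apply: eq_bigr => i _; rewrite !mxE normCK. Qed.

Lemma row_sqnorm_ge0 {n : nat} (x : 'rV[C]_n) : 0 <= (x *m x^*t) 0 0.
Proof. by rewrite row_sqnormE sumr_ge0 // => i _; rewrite exprn_ge0. Qed.

Lemma row_sqnorm_gt0 {n : nat} (x : 'rV[C]_n) : x != 0 -> 0 < (x *m x^*t) 0 0.
Proof.
move=> x0; rewrite lt_def row_sqnorm_ge0 andbT row_sqnormE.
apply: contraNneq x0 => /eqP.
rewrite psumr_eq0 => [/allP x0|i _]; last by rewrite exprn_ge0.
apply/eqP/rowP => i; have := x0 i (mem_index_enum i).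
by rewrite mxE sqrf_eq0 normr_eq0 => /eqP.
Qed.

(** For an eigenvector [x] one has
    [(a - lambda) x x* = x B B* x* = (x B) (x B)* >= 0] while [x x* > 0]. *)
Lemma eigenvalue_le_sub_gram {m n : nat} (A : 'M[C]_m) (B : 'M[C]_(m, n))
    (a lambda : C) :
  A = a%:M - B *m B^*t -> eigenvalue A lambda -> lambda <= a.
Proof.
move=> AE /eigenvalueP[x xA /row_sqnorm_gt0 x_gt0].
rewrite -subr_ge0 -(pmulr_lge0 _ x_gt0).
suff -> : (a - lambda) * (x *m x^*t) 0 0 = ((x *m B) *m (x *m B)^*t) 0 0.
  exact: row_sqnorm_ge0.
have -> : (x *m B) *m (x *m B)^*t = (a - lambda) *: (x *m x^*t).
  rewrite trmx_mul map_mxM mulmxA -(mulmxA x) scalemxAl; congr (_ *m _).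
  by rewrite scalerBl -xA AE mulmxBr mul_mx_scalar subKr.
by rewrite [RHS]mxE.
Qed.

End Gram.

Section LineAdjacency.
Variables (C : numClosedFieldType) (G : sgraph).

Lemma card_edge (e : edge G) : #|val e| = 2.
Proof.
have /edgesP[u [v [uv ->]]] := valP e; rewrite cards2.
by have [uE|//] := eqVneq u v; move: uv; rewrite uE adj_irrefl.
Qed.

(** This is where the graph being simple matters: two edges with the same two
    endpoints are equal. *)
Lemma line_adj_capE (e f : edge G) (v : G) :
  e != f -> v \in val e -> v \in val f -> val e :&: val f = [set v].
Proof.
move=> eDf ve vf; apply/esym/eqP; rewrite eqEcard sub1set inE ve vf cards1 /=.
rewrite leqNgt; apply: contra eDf => ef_gt1; apply/eqP/val_inj.
have /eqP <- : val e :&: val f == val e by rewrite eqEcard subsetIl card_edge.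
by apply/eqP; rewrite eqEcard subsetIr card_edge.
Qed.

Variables (omega : incidence_phase C G) (zeta : line_graph G -> C).
Hypothesis zeta1 : forall e, `|zeta e| = 1.

Definition switched_phase (v : G) (e : edge G) : C := omega v (val e) * zeta e.

Local Notation h := switched_phase.

(** Rows are indexed by edges because eigenvectors are row vectors; the
    conjugation then puts the inverse on the phase of the first edge, as in the
    gains of the line graph. *)
Definition switched_coincidence : 'M[C]_(#|line_graph G|, #|G|) :=
  \matrix_(i, j) (h (enum_val j) (enum_val i))^*.

Lemma switched_phase_norm v (e : edge G) : v \in val e -> `|h v e| = 1.
Proof. by move=> ve; rewrite normrM phase_norm ?(valP e) // zeta1 mulr1. Qed.

Lemma switched_phase0 v (e : edge G) : v \notin val e -> h v e = 0.
Proof.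
by move=> ve; rewrite /switched_phase phase0 ?mul0r // negb_and ve orbT.
Qed.

Lemma sum_phase_cap (e f : edge G) :
  \sum_v (h v e)^* * h v f = \sum_(v in val e :&: val f) (h v e)^* * h v f.
Proof.
rewrite [RHS]big_mkcond; apply: eq_bigr => v _; rewrite inE.
have [ve|/switched_phase0->] := boolP (v \in val e); last by rewrite conjC0 mul0r.
by have [//|/switched_phase0->] := boolP (v \in val f); rewrite mulr0.
Qed.

Lemma sum_phase_diag (e : edge G) : \sum_v (h v e)^* * h v e = 2.
Proof.
rewrite sum_phase_cap setIid (eq_bigr (fun=> 1)) ?sumr_const ?card_edge //.
by move=> v ve; rewrite mulrC -normCK switched_phase_norm // expr1n.
Qed.

(** Switching the line graph amounts to rescaling the columns of the incidence
    matrix: the factors [zeta e] and [zeta f] go into the phases of [e] and [f]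
    at their common endpoint. *)
Lemma switched_line_gainE (e f : edge G) (v : G) :
    e != f -> v \in val e -> v \in val f ->
  switch_fun (phase_gain (line_phase omega)) zeta e f = - ((h v e)^* * h v f).
Proof.
move=> eDf ve vf; have ef : adj (e : line_graph G) f.
  by rewrite /= /line_adj eDf; apply/existsP; exists v; rewrite ve.
rewrite /switch_fun /= /phase_gain_fun /= /line_phase_fun adj_edge // set21 set22.
case: pickP => [w /forall_inP wF|/(_ v)/negP[]]; last first.
  by apply/forall_inP => g; rewrite !inE => /orP[]/eqP->.
have -> : w = v.
  by apply/set1P; rewrite -(line_adj_capE _ _ _ eDf ve vf) inE !wF ?set21 ?set22.
(* On the unit circle, conjugation is inversion. *)
have -> : (h v e)^* = (h v e)^-1.
  by rewrite invC_norm switched_phase_norm // expr1n invr1 mul1r.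
rewrite /frak_s /switched_phase invfM invrK mulrN1 mulNr mulrN mulNr; congr (- _).
by rewrite -!mulrA mulrCA.
Qed.

Lemma adjacency_line_class (Psi : gain_graph C (line_graph G)) :
    gain_eq Psi (switch (phase_gain (line_phase omega)) zeta1) ->
  adjacency Psi = 2%:M
    - switched_coincidence *m map_mx Num.conj (switched_coincidence^T).
Proof.
move=> PsiE; apply/matrixP => i k.
have gramE : (switched_coincidence
      *m map_mx Num.conj (switched_coincidence^T)) i k
    = \sum_v (h v (enum_val i))^* * h v (enum_val k).
  rewrite mxE [RHS](reindex _ (onW_bij _ (enum_val_bij G))) /=.
  by apply: eq_bigr => j _; rewrite !mxE conjCK.
rewrite [RHS]mxE [X in _ + X]mxE gramE !mxE.
have [<-|iDk] := eqVneq i k; first by rewrite adj_irrefl sum_phase_diag subrr.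
have eDf : enum_val i != enum_val k by rewrite (inj_eq enum_val_inj).
rewrite mulr0n sub0r; case: ifP => [ef|/negbT ef].
  rewrite PsiE //; case/andP: ef => _ /existsP[v /andP[ve vf]].
  rewrite [LHS](switched_line_gainE _ _ v) // sum_phase_cap.
  by rewrite (line_adj_capE _ _ v) // big_set1.
rewrite sum_phase_cap big1 ?oppr0 // => v; rewrite inE => vef.
by case/negP: ef; rewrite /= /line_adj eDf; apply/existsP; exists v.
Qed.

End LineAdjacency.

Theorem theorem5p4 (R : realType) (G : sgraph) (Phi : gain_graph R[i] G)
    (Psi : gain_graph R[i] (line_graph G)) (lambda : R[i]) :
  line_class Phi Psi -> eigenvalue (adjacency Psi) lambda -> lambda <= 2.
Proof.
case=> omega _ [zeta [zeta1 PsiE]].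
exact: eigenvalue_le_sub_gram (adjacency_line_class _ _ _ _ zeta1 _ PsiE).
Qed.
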